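(* Every $n$-dimensional ($n\ge 2$) totally umbilical non-invariant slant submanifold of a $2n$-dimensional Kaehler manifold is totally geodesic.
   Context: All dimensions are real dimensions. Let $M$ be a submanifold of an almost Hermitian manifold $(\widetilde M,J,g)$. For a nonzero $X\in T_pM$ the Wirtinger angle $\theta(X)$ is the angle between $JX$ and $T_pM$. $M$ is a slant submanifold if $\theta(X)$ is independent of the choice of $p\in M$ and of nonzero $X\in T_pM$; the constant value $\theta\in[0,\pi/2]$ is the slant angle. A slant submanifold is non-invariant if $\theta\neq 0$ (thus $\theta=\pi/2$ is allowed). Let $\sigma$ be the second fundamental form of $M$ and $H=\frac1n\mathrm{trace}(\sigma)$ the mean curvature vector. $M$ is totally umbilical if $\sigma(X,Y)=g(X,Y)H$ for all $X,Y$ tangent to $M$ at every point, and totally geodesic if $\sigma=0$ at every point. *)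

(* Defs.v *)
From HB Require Import structures.
From mathcomp Require Import all_boot all_order all_algebra.
From mathcomp Require Import all_classical all_reals all_analysis.

Set Implicit Arguments.
Unset Strict Implicit.
Unset Printing Implicit Defensive.

Import Order.TTheory GRing.Theory Num.Theory.
Import numFieldNormedType.Exports.

Local Open Scope classical_set_scope.
Local Open Scope ring_scope.

(* Vectors are row vectors, as for the Jacobian ['J f x] of the library:
   ['d f x v = v *m 'J f x], and an endomorphism A acts by [v *m A]. *)

Definition partial (R : realType) (m : nat) (V : normedModType R)
    (i : 'I_m) (f : 'rV[R]_m -> V) (x : 'rV[R]_m) : V :=
  'D_(delta_mx 0 i) f x.

(* [U] is meant to be open. *)
Fixpoint Ck_on (R : realType) (m : nat) (V : normedModType R) (k : nat)
    (U : set 'rV[R]_m) (f : 'rV[R]_m -> V) : Prop :=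
  match k with
  | 0 => forall x, U x -> {for x, continuous f}
  | k'.+1 => (forall x, U x -> differentiable f x) /\
             (forall i : 'I_m, Ck_on k' U (partial i f))
  end.

Definition smooth_on (R : realType) (m : nat) (V : normedModType R)
    (U : set 'rV[R]_m) (f : 'rV[R]_m -> V) : Prop :=
  forall k, Ck_on k U f.

(** * Smooth manifolds *)

(* [cparam c] is only meaningful on [ccoord c @` cdom c]. *)
Record smoothManifold (R : realType) (m : nat) := SmoothManifold {
  points :> topologicalType;
  points_hausdorff : hausdorff_space points;
  points_second_countable : @second_countable points;
  chart : Type;
  cdom : chart -> set points;
  ccoord : chart -> points -> 'rV[R]_m;
  cparam : chart -> 'rV[R]_m -> points;
  cdom_open : forall c, open (cdom c);
  cdom_cover : forall p, exists c, cdom c p;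
  ccoord_open : forall c, open (ccoord c @` cdom c);
  ccoordK : forall c p, cdom c p -> cparam c (ccoord c p) = p;
  ccoord_continuous : forall c p, cdom c p -> {for p, continuous (ccoord c)};
  cparam_continuous : forall c p, cdom c p ->
    {for ccoord c p, continuous (cparam c)};
  transition_smooth : forall c d,
    smooth_on (ccoord c @` (cdom c `&` cdom d)) (ccoord d \o cparam c)
}.

(** * Riemannian, almost Hermitian and Kaehler manifolds *)

Definition pairing (R : realType) (m : nat) (G : 'M[R]_m) (u v : 'rV[R]_m) : R :=
  (u *m G *m v^T) 0 0.

(* A tensor field is given by its components in each chart, smooth there and
   subject to its transformation law under changes of charts. *)
Record riemannianManifold (R : realType) (m : nat) := RiemannianManifold {
  riem_manifold :> smoothManifold R m;
  metric : chart riem_manifold -> 'rV[R]_m -> 'M[R]_m;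
  metric_smooth : forall c, smooth_on (ccoord c @` cdom c) (metric c);
  metric_sym : forall c p, cdom c p ->
    (metric c (ccoord c p))^T = metric c (ccoord c p);
  metric_pos : forall c p, cdom c p -> forall v, v != 0 ->
    0 < pairing (metric c (ccoord c p)) v v;
  metric_change : forall c d p, cdom c p -> cdom d p -> forall u v,
    let T := 'd (ccoord d \o cparam c) (ccoord c p) in
    pairing (metric c (ccoord c p)) u v
    = pairing (metric d (ccoord d p)) (T u) (T v)
}.

Record almostHermitianManifold (R : realType) (m : nat) :=
  AlmostHermitianManifold {
  ah_manifold :> riemannianManifold R m;
  acs : chart ah_manifold -> 'rV[R]_m -> 'M[R]_m;
  acs_smooth : forall c, smooth_on (ccoord c @` cdom c) (acs c);
  acs_sqr : forall c p, cdom c p ->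
    acs c (ccoord c p) *m acs c (ccoord c p) = - 1%:M;
  acs_change : forall c d p, cdom c p -> cdom d p -> forall v,
    let T := 'd (ccoord d \o cparam c) (ccoord c p) in
    T (v *m acs c (ccoord c p)) = T v *m acs d (ccoord d p);
  acs_isometry : forall c p, cdom c p -> forall u v,
    pairing (metric c (ccoord c p))
      (u *m acs c (ccoord c p)) (v *m acs c (ccoord c p))
    = pairing (metric c (ccoord c p)) u v
}.

(* Christoffel symbol Gamma^k_ij of the Levi-Civita connection of the metric
   with components [g], at [x]. *)
Definition christoffel (R : realType) (m : nat) (g : 'rV[R]_m -> 'M[R]_m)
    (x : 'rV[R]_m) (k i j : 'I_m) : R :=
  2^-1 * \sum_(l < m) invmx (g x) k l *
    (partial i (fun y => g y j l) x + partial j (fun y => g y i l) x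
     - partial l (fun y => g y i j) x).

Definition christoffel_form (R : realType) (m : nat) (g : 'rV[R]_m -> 'M[R]_m)
    (x u v : 'rV[R]_m) : 'rV[R]_m :=
  \row_k \sum_(i < m) \sum_(j < m) u 0 i * v 0 j * christoffel g x k i j.

(* (nabla_u J) v = nabla_u (J v) - J (nabla_u v), for v extended to the
   constant vector field of the chart. *)
Definition cov_deriv_endo (R : realType) (m : nat) (g J : 'rV[R]_m -> 'M[R]_m)
    (x u v : 'rV[R]_m) : 'rV[R]_m :=
  (v *m 'D_u J x + christoffel_form g x u (v *m J x))
  - christoffel_form g x u v *m J x.

Record kaehlerManifold (R : realType) (m : nat) := KaehlerManifold {
  kaehler_ah :> almostHermitianManifold R m;
  acs_parallel : forall (c : chart kaehler_ah) p, cdom c p -> forall u v,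
    cov_deriv_endo (metric c) (acs c) (ccoord c p) u v = 0
}.

(** * Submanifolds *)

Definition local_rep (R : realType) (n m : nat) (M : smoothManifold R n)
    (N : smoothManifold R m) (f : M -> N) (c : chart M) (d : chart N) :
    'rV[R]_n -> 'rV[R]_m :=
  ccoord d \o f \o cparam c.

Definition smooth_map (R : realType) (n m : nat) (M : smoothManifold R n)
    (N : smoothManifold R m) (f : M -> N) : Prop :=
  continuous f /\
  forall c d, smooth_on (ccoord c @` (cdom c `&` f @^-1` cdom d))
                        (local_rep f c d).

Definition charts_at (R : realType) (n m : nat) (M : smoothManifold R n)
    (N : smoothManifold R m) (f : M -> N) (p : M) (c : chart M) (d : chart N) :
    Prop :=
  cdom c p /\ cdom d (f p).

Definition immersion (R : realType) (n m : nat) (M : smoothManifold R n)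
    (N : smoothManifold R m) (f : M -> N) : Prop :=
  smooth_map f /\
  forall p c d, charts_at f p c d ->
    injective ('d (local_rep f c d) (ccoord c p)).

(* Below, a tangent vector X of M at p is represented by its components
   [u : 'rV_n] in the chart [c], and vectors of T_(f p) N by their components
   in the chart [d]; all quantities transform as tensors, and the predicates on
   submanifolds quantify over all charts [c] at p and [d] at [f p]. *)

(* The rows are the vectors f_* (d/dx_a), so f_* u is [u *m push f p c d]. *)
Definition push (R : realType) (n m : nat) (M : smoothManifold R n)
    (N : smoothManifold R m) (f : M -> N) (p : M) (c : chart M) (d : chart N) :
    'M[R]_(n, m) :=
  'J (local_rep f c d) (ccoord c p).

Definition tangent_space (R : realType) (n m : nat) (M : smoothManifold R n)
    (N : smoothManifold R m) (f : M -> N) (p : M) (c : chart M) (d : chart N) :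
    'M[R]_m :=
  <<push f p c d>>%MS.

(* Row space: the vectors v with g(v, f_* u) = 0 for all u. *)
Definition normal_space (R : realType) (n m : nat) (M : smoothManifold R n)
    (N : riemannianManifold R m) (f : M -> N) (p : M)
    (c : chart M) (d : chart N) : 'M[R]_m :=
  kermx (metric d (ccoord d (f p)) *m (push f p c d)^T).

Definition normal_part (R : realType) (n m : nat) (M : smoothManifold R n)
    (N : riemannianManifold R m) (f : M -> N) (p : M)
    (c : chart M) (d : chart N) (w : 'rV[R]_m) : 'rV[R]_m :=
  w *m proj_mx (normal_space f p c d) (tangent_space f p c d).

Definition induced_metric (R : realType) (n m : nat) (M : smoothManifold R n)
    (N : riemannianManifold R m) (f : M -> N) (p : M)
    (c : chart M) (d : chart N) : 'M[R]_n :=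
  push f p c d *m metric d (ccoord d (f p)) *m (push f p c d)^T.

(* sigma(u, v) is the normal part of the ambient covariant derivative along u
   of f_* V, where V is the constant extension of v in the chart [c]. *)
Definition second_fundamental_form (R : realType) (n m : nat)
    (M : smoothManifold R n) (N : riemannianManifold R m) (f : M -> N) (p : M)
    (c : chart M) (d : chart N) (u v : 'rV[R]_n) : 'rV[R]_m :=
  let F := local_rep f c d in
  let x := ccoord c p in
  normal_part f p c d
    ('D_u (fun z => 'd F z v) x
     + christoffel_form (metric d) (ccoord d (f p)) ('d F x u) ('d F x v)).

(* H = (1/n) sum_ab G^ab sigma(d/dx_a, d/dx_b), the trace being taken with
   respect to the induced metric G. *)
Definition mean_curvature (R : realType) (n m : nat)
    (M : smoothManifold R n) (N : riemannianManifold R m) (f : M -> N) (p : M)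
    (c : chart M) (d : chart N) : 'rV[R]_m :=
  n%:R^-1 *: \sum_(a < n) \sum_(b < n)
    invmx (induced_metric f p c d) a b *:
      second_fundamental_form f p c d (delta_mx 0 a) (delta_mx 0 b).

Definition totally_umbilical (R : realType) (n m : nat)
    (M : smoothManifold R n) (N : riemannianManifold R m) (f : M -> N) : Prop :=
  forall p c d, charts_at f p c d -> forall u v,
    second_fundamental_form f p c d u v
    = pairing (induced_metric f p c d) u v *: mean_curvature f p c d.

Definition totally_geodesic (R : realType) (n m : nat)
    (M : smoothManifold R n) (N : riemannianManifold R m) (f : M -> N) : Prop :=
  forall p c d, charts_at f p c d -> forall u v,
    second_fundamental_form f p c d u v = 0.

(** * Slant submanifolds *)

Definition vector_angle (R : realType) (m : nat) (G : 'M[R]_m)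
    (v w : 'rV[R]_m) : R :=
  acos (pairing G v w / (Num.sqrt (pairing G v v) * Num.sqrt (pairing G w w))).

(* The angle between a nonzero vector and the (nonzero) row space of [W] is the
   least angle between this vector and the nonzero vectors of that space. *)
Definition subspace_angle (R : realType) (m : nat) (G : 'M[R]_m)
    (v : 'rV[R]_m) (W : 'M[R]_m) : R :=
  inf [set vector_angle G v w | w in [set w | (w <= W)%MS /\ w != 0]].

Definition wirtinger_angle (R : realType) (n m : nat) (M : smoothManifold R n)
    (N : almostHermitianManifold R m) (f : M -> N) (p : M)
    (c : chart M) (d : chart N) (u : 'rV[R]_n) : R :=
  let y := ccoord d (f p) in
  subspace_angle (metric d y) ('d (local_rep f c d) (ccoord c p) u *m acs d y)
    (tangent_space f p c d).

Definition slant_with_angle (R : realType) (n m : nat) (M : smoothManifold R n)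
    (N : almostHermitianManifold R m) (f : M -> N) (theta : R) : Prop :=
  forall p c d, charts_at f p c d -> forall u, u != 0 ->
    wirtinger_angle f p c d u = theta.

Definition non_invariant_slant (R : realType) (n m : nat)
    (M : smoothManifold R n) (N : almostHermitianManifold R m) (f : M -> N) :
    Prop :=
  exists2 theta, slant_with_angle f theta & theta != 0.

(* Main.v *)
Require Import Defs.
From mathcomp Require Import all_boot all_order all_algebra.
From mathcomp Require Import all_classical all_reals all_analysis.
From mathcomp Require Import ring lra.

Set Implicit Arguments.
Unset Strict Implicit.
Unset Printing Implicit Defensive.

Import Order.TTheory GRing.Theory Num.Theory.
Import numFieldNormedType.Exports.

Local Open Scope classical_set_scope.
Local Open Scope ring_scope.

(** Write g for the metric, J for the complex structure, X and Y for tangent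
vectors of M, and P X for the tangential part of J X.

The Wirtinger angle of X is the arc cosine of |P X| / |X|
([subspace_angleE]), so being slant with angle theta means
|P X|^2 = c |X|^2 with the same constant c = cos^2 theta at all points, and
c != 1 when M is not invariant.

Let omega(X, Y) = g (J X, Y) be the fundamental form restricted to M.  As the
ambient connection preserves g and J, the derivatives of g(X, Y) and omega(X, Y)
along a direction k only involve the ambient derivatives of the two pushed
forward fields ([is_derive_induced_pairing], [is_derive_fundamental_form]).  For
a totally umbilical M the ambient derivative of X along k is g(k, X) H plus a
tangent vector.  The tangential terms act on g and omega like an infinitesimal
change of frame, and the only other contribution is

  S_k (X, Y) = g(k, Y) alpha X - g(k, X) alpha Y,  with alpha X = g(H, J X),

which enters the derivative of omega.  The slant condition controls S in two
different ways.

- If c = 0 then omega vanishes identically, hence S = 0.  Since n >= 2, each Y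
  is orthogonal to some k != 0, and S_k (k, Y) = - |k|^2 alpha Y gives alpha = 0
  ([slant_lagrangian_orth]).

- If c != 0, the function c |X|^2 |Y|^2 - omega(X, Y)^2 is nonnegative for all
  points and all X, Y by the Cauchy-Schwarz inequality, and vanishes for
  Y = P X.  With X and Y constant in a chart, this is a minimum, so the
  derivative is zero; what remains of it after the frame terms have cancelled is
  S_k (X, P X) = 0.  As g(X, P X) = 0, for k = X this reads
  |X|^2 alpha (P X) = 0, and P is invertible, so alpha = 0
  ([slant_proper_orth]).  This minimality argument replaces the differentiation
  of the identity P^2 = - c, and with it that of an inverse matrix.

In both cases H is orthogonal to T M and to J (T M).  As c != 1, these two
spaces of dimension n meet trivially and span the ambient tangent space of
dimension 2n, so H = 0 ([slant_normal_trivial]) and sigma = 0. *)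

(** * Directional derivatives *)

Section DirectionalDerivatives.
Context {R : realType} {V : normedModType R}.

Lemma is_derive_mxP m n (A : V -> 'M[R]_(m, n)) x v dA :
  is_derive x v A dA <->
  forall i j, is_derive x v (fun z => A z i j) (dA i j).
Proof.
split=> [[Ax <-] i j|Aij].
  rewrite (derive_mx Ax) mxE; apply: derivableP.
  exact: (derivable_mxP A x v).1 Ax i j.
have Ax : derivable A x v by apply/derivable_mxP => i j; case: (Aij i j).
apply: DeriveDef => //; rewrite (derive_mx Ax); apply/matrixP => i j.
by rewrite mxE; case: (Aij i j).
Qed.

Lemma is_derive_mulmx m n p (A : V -> 'M[R]_(m, n)) (B : V -> 'M[R]_(n, p))
    x v dA dB :
  is_derive x v A dA -> is_derive x v B dB ->
  is_derive x v (fun z => A z *m B z) (dA *m B x + A x *m dB).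
Proof.
move=> /is_derive_mxP Ax /is_derive_mxP Bx; apply/is_derive_mxP => i j.
have -> : (fun z => (A z *m B z) i j) =
    \sum_(k < n) ((fun z => A z i k) * (fun z => B z k j)).
  by apply/funext => z; rewrite fct_sumE mxE.
apply: is_derive_eq.
rewrite !mxE -big_split; apply: eq_bigr => k _ /=.
by rewrite addrC [dA i k * _]mulrC.
Qed.

Lemma is_derive_trmx m n (A : V -> 'M[R]_(m, n)) x v dA :
  is_derive x v A dA -> is_derive x v (fun z => (A z)^T) dA^T.
Proof.
move=> /is_derive_mxP Ax; apply/is_derive_mxP => i j.
rewrite mxE (_ : (fun z => _) = (fun z => A z j i)) //.
by apply/funext => z; rewrite mxE.
Qed.

(** The difference quotients are nonnegative on the right of 0 and nonpositive on
its left. *)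
Lemma is_derive_local_min (f : V -> R) x v df :
  is_derive x v f df -> (\forall z \near x, f x <= f z) -> df = 0.
Proof.
move=> [fx <-] fmin.
have fminv : \forall h \near (0 : R), f x <= f (h *: v + x).
  have : (fun h : R => h *: v + x) @ 0 --> x.
    rewrite -[X in _ --> X]add0r -[X in _ --> X + _](scale0r v).
    by apply: cvgD; [apply: cvgZr_tmp; exact: cvg_id|exact: cvg_cst].
  by move=> /(_ _ fmin).
have fxv : (fun h => h^-1 *: (f (h *: v + x) - f x)) @ 0^' --> 'D_v f x by [].
have lim_left : (fun h => h^-1 *: (f (h *: v + x) - f x)) @ 0^'- --> 'D_v f x.
  exact: cvg_dnbhs_at_left fxv.
have lim_right : (fun h => h^-1 *: (f (h *: v + x) - f x)) @ 0^'+ --> 'D_v f x.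
  exact: cvg_dnbhs_at_right fxv.
apply/eqP; rewrite eq_le; apply/andP; split; rewrite leNgt; apply/negP => D0.
- have : \forall h \near (0 : R)^'-, False; last by move/filter_ex => [].
  near=> h.
  have : 0 < h^-1 *: (f (h *: v + x) - f x).
    by near: h; exact: cvgr_gt lim_left _ D0.
  rewrite ltNge => /negP; apply; rewrite nmulr_rle0.
    by rewrite subr_ge0; near: h; exact: cvg_within fminv.
  by rewrite invr_lt0; near: h; exact: nbhs_left_lt.
- have : \forall h \near (0 : R)^'+, False; last by move/filter_ex => [].
  near=> h.
  have : h^-1 *: (f (h *: v + x) - f x) < 0.
    by near: h; exact: cvgr_lt lim_right _ D0.
  rewrite ltNge => /negP; apply; rewrite pmulr_rge0.
    by rewrite subr_ge0; near: h; exact: cvg_within fminv.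
  by rewrite invr_gt0; near: h; exact: nbhs_right_gt.
Unshelve. all: by end_near. Qed.

End DirectionalDerivatives.

Section ComponentDerivatives.
Context {R : realType}.

Lemma derive_partial n (W : normedModType R) (f : 'rV[R]_n -> W) x v :
  differentiable f x -> 'D_v f x = \sum_i v 0 i *: partial i f x.
Proof.
move=> fx; rewrite deriveE // {1}[v]row_sum_delta linear_sum.
by apply: eq_bigr => i _; rewrite linearZ /partial deriveE.
Qed.

Lemma is_derive_comp_diff (U V W : normedModType R) (f : V -> W) (g : U -> V)
    x v :
  differentiable g x -> differentiable f (g x) ->
  is_derive x v (f \o g) ('D_('d g x v) f (g x)).
Proof.
move=> gx fgx.
have fg : differentiable (f \o g) x by exact: differentiable_comp.
by apply: DeriveDef; [exact: diff_derivable|rewrite !deriveE // diff_comp].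
Qed.

(** The field z |-> 'd f z v is near x a fixed linear combination of partial
derivatives of f, hence inherits their differentiability. *)
Lemma derivable_diff_const n (W : normedModType R) (f : 'rV[R]_n -> W) x k v :
  (\forall z \near x, differentiable f z) ->
  (forall i, differentiable (partial i f) x) ->
  derivable (fun z => 'd f z v) x k.
Proof.
move=> fx pfx.
apply: (@near_eq_derivable _ _ _ (\sum_i v 0 i *: partial i f)).
  apply: filterS fx => z fz; rewrite fct_sumE -deriveE // derive_partial //.
apply: derivable_sum => i; apply: derivableZ; exact: diff_derivable.
Qed.

End ComponentDerivatives.

(** The case of interest is h1 = g(X, X), h2 = g(Y, Y) and w = g(J X, Y) for
X and Y constant in a chart: the function is then nonnegative on a slant
submanifold with c = cos^2 theta. *)
Lemma is_derive_slant_defect {R : realType} {V : normedModType R} (h1 h2 w : V -> R)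
    x v (c dh1 dh2 dw : R) :
  is_derive x v h1 dh1 -> is_derive x v h2 dh2 -> is_derive x v w dw ->
  is_derive x v (fun z => c * (h1 z * h2 z) - w z ^+ 2)
    (c * (dh1 * h2 x + h1 x * dh2) - 2 * w x * dw).
Proof.
move=> h1x h2x wx.
have h12x := is_deriveZ c (is_deriveM h1x h2x).
apply: (is_derive_eq (is_deriveB h12x (is_deriveX 2 wx))).
rewrite /GRing.scale /= expr1; ring.
Qed.

(** * Inner products *)

Section Pairing.
Context {R : realType} {m : nat}.
Implicit Types (G : 'M[R]_m) (u v w : 'rV[R]_m) (k : R).

Lemma pairingDl G u v w : pairing G (u + v) w = pairing G u w + pairing G v w.
Proof. by rewrite /pairing !mulmxDl mxE. Qed.
Lemma pairingDr G u v w : pairing G w (u + v) = pairing G w u + pairing G w v.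
Proof. by rewrite /pairing linearD /= mulmxDr mxE. Qed.
Lemma pairingZl G k u w : pairing G (k *: u) w = k * pairing G u w.
Proof. by rewrite /pairing -!scalemxAl mxE. Qed.
Lemma pairingZr G k u w : pairing G w (k *: u) = k * pairing G w u.
Proof. by rewrite /pairing linearZ /= -scalemxAr mxE. Qed.
Lemma pairingNl G u w : pairing G (- u) w = - pairing G u w.
Proof. by rewrite -scaleN1r pairingZl mulN1r. Qed.
Lemma pairingNr G u w : pairing G w (- u) = - pairing G w u.
Proof. by rewrite -scaleN1r pairingZr mulN1r. Qed.
Lemma pairing0l G w : pairing G 0 w = 0.
Proof. by rewrite /pairing !mul0mx mxE. Qed.
Lemma pairing0r G w : pairing G w 0 = 0.
Proof. by rewrite /pairing trmx0 mulmx0 mxE. Qed.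

Lemma pairingE G u v :
  pairing G u v = \sum_i \sum_j u 0 i * v 0 j * G i j.
Proof.
rewrite /pairing !mxE exchange_big; apply: eq_bigr => j _.
rewrite !mxE mulr_suml; apply: eq_bigr => i _.
by rewrite mulrAC.
Qed.

Lemma pairingC G u v : G^T = G -> pairing G u v = pairing G v u.
Proof.
move=> sG; rewrite !pairingE exchange_big; apply: eq_bigr => i _.
apply: eq_bigr => j _; have -> : G j i = G i j by rewrite -{1}sG mxE.
by rewrite [v _ _ * _]mulrC.
Qed.

Lemma is_derive_pairing (V : normedModType R) (G : V -> 'M[R]_m)
    (a b : V -> 'rV[R]_m) (x d : V) dG da db :
  is_derive x d G dG -> is_derive x d a da -> is_derive x d b db ->
  is_derive x d (fun z => pairing (G z) (a z) (b z))
    (pairing dG (a x) (b x) + pairing (G x) da (b x) + pairing (G x) (a x) db).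
Proof.
move=> Gx ax bx.
have := is_derive_mulmx (is_derive_mulmx ax Gx) (is_derive_trmx bx).
move=> /is_derive_mxP/(_ 0 0) Dx; apply: (is_derive_eq Dx).
rewrite mulmxDl mxE [X in X + _]mxE -!/(pairing _ _ _); ring.
Qed.

End Pairing.

Section InnerProduct.
Context {R : realType} {m : nat} (G : 'M[R]_m).
Hypotheses (G_sym : G^T = G) (G_pos : forall v, v != 0 -> 0 < pairing G v v).
Implicit Types u v w : 'rV[R]_m.

Lemma pairing_ge0 v : 0 <= pairing G v v.
Proof.
have [->|/G_pos/ltW //] := eqVneq v 0; by rewrite pairing0l.
Qed.

Lemma pairing_eq0 v : (pairing G v v == 0) = (v == 0).
Proof.
apply/eqP/eqP => [Gv|->]; last exact: pairing0l.
by apply/eqP/negPn/negP => /G_pos; rewrite Gv ltxx.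
Qed.

Lemma cauchy_schwarz v w :
  pairing G v w ^+ 2 <= pairing G v v * pairing G w w.
Proof.
have [->|w0] := eqVneq w 0; first by rewrite !pairing0r expr0n mulr0.
have w_gt0 := G_pos w0.
(* The projection of v orthogonally to w, scaled by <w, w> to avoid dividing. *)
have := pairing_ge0 (pairing G w w *: v - pairing G v w *: w).
rewrite !(pairingDl, pairingDr, pairingNl, pairingNr, pairingZl, pairingZr).
rewrite (pairingC w v G_sym) => h.
rewrite -subr_ge0 -(pmulr_rge0 _ w_gt0); apply: le_trans h _.
by rewrite le_eqVlt; apply/orP; left; apply/eqP; ring.
Qed.

Lemma posdef_unitmx : G \in unitmx.
Proof.
rewrite -row_free_unit -kermx_eq0; apply/rowV0P => v /sub_kermxP vG.
by apply/eqP; rewrite -pairing_eq0 /pairing vG mul0mx mxE.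
Qed.

End InnerProduct.

(** * The angle between a vector and a subspace *)

Lemma le_acos (R : realType) (a b : R) :
  -1 <= a -> a <= b -> b <= 1 -> acos b <= acos a.
Proof.
move=> a1 ab b1.
have aI : -1 <= a <= 1 by rewrite a1 (le_trans ab).
have bI : -1 <= b <= 1 by rewrite b1 (le_trans a1).
rewrite leNgt; apply/negP; rewrite -ltr_cos ?in_itv/= ?acos_ge0 ?acos_lepi //.
by rewrite !acosK ?in_itv//= ltNge ab.
Qed.

Section Angle.
Context {R : realType} {m : nat} (G : 'M[R]_m).
Hypotheses (G_sym : G^T = G) (G_pos : forall v, v != 0 -> 0 < pairing G v v).

Let len v := Num.sqrt (pairing G v v).

Lemma cauchy_schwarz_ratio v w : v != 0 -> w != 0 ->
  `|pairing G v w / (len v * len w)| <= 1.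
Proof.
move=> v0 w0.
have lv : 0 < len v by rewrite sqrtr_gt0 G_pos.
have lw : 0 < len w by rewrite sqrtr_gt0 G_pos.
rewrite normrM normfV [X in _ / X]ger0_norm ?(ltW (mulr_gt0 _ _)) //.
rewrite ler_pdivrMr ?mulr_gt0 // mul1r -sqrtrM ?pairing_ge0 //.
by rewrite -sqrtr_sqr ler_wsqrtr // cauchy_schwarz.
Qed.

(** The least angle from v to W is reached at the orthogonal projection t of v,
by the Cauchy-Schwarz inequality <v, w> = <t, w> <= |t| |w|.  If t = 0 all the
vectors of W are orthogonal to v, and W != 0 provides one. *)
Lemma subspace_angleE v t (W : 'M[R]_m) : v != 0 -> W != 0 ->
  (t <= W)%MS -> (forall w, (w <= W)%MS -> pairing G v w = pairing G t w) ->
  subspace_angle G v W = acos (len t / len v).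
Proof.
move=> v0 W0 tW vt.
have lv : 0 < len v by rewrite sqrtr_gt0 G_pos.
have le_ratio w : (w <= W)%MS -> w != 0 ->
    pairing G v w / (len v * len w) <= len t / len v.
  move=> wW w0; have lw : 0 < len w by rewrite sqrtr_gt0 G_pos.
  rewrite vt // ler_pdivrMr ?mulr_gt0 // mulrA divfK ?gt_eqF //.
  rewrite -sqrtrM ?pairing_ge0 //; apply: le_trans (ler_norm _) _.
  by rewrite -sqrtr_sqr ler_wsqrtr // cauchy_schwarz.
have [w0 [w0W w0_neq0 w0E]] : exists w, [/\ (w <= W)%MS, w != 0 &
    pairing G v w / (len v * len w) = len t / len v].
  have [t0|t0] := eqVneq t 0.
    have /row_subPn : ~~ (W <= (0 : 'M[R]_m))%MS by rewrite submx0.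
    case=> i; rewrite submx0 => Wi; exists (row i W).
    by rewrite row_sub Wi vt ?row_sub // t0 /len !pairing0l sqrtr0 !mul0r.
  exists t; split => //; have lt : 0 < len t by rewrite sqrtr_gt0 G_pos.
  rewrite vt // -[X in X / _](sqr_sqrtr (pairing_ge0 G_pos t)) -/(len t).
  by field; rewrite !gt_eqF.
rewrite /subspace_angle; apply/eqP; rewrite eq_le; apply/andP; split.
  apply: ge_inf; last by exists w0; rewrite // /vector_angle w0E.
  exists 0 => _ [w [wW wn] <-]; apply: acos_ge0.
  by rewrite -ler_norml cauchy_schwarz_ratio.
apply: lb_le_inf.
  by exists (acos (len t / len v)), w0; rewrite // /vector_angle w0E.
move=> _ [w [wW wn] <-]; apply: le_acos.
- by have := cauchy_schwarz_ratio v0 wn; rewrite ler_norml => /andP[].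
- exact: le_ratio.
- rewrite -w0E; have := cauchy_schwarz_ratio v0 w0_neq0.
  by rewrite ler_norml => /andP[].
Qed.

End Angle.

(** * Tangent and normal spaces *)

Section TangentNormal.
Context {R : realType} {n m : nat} (G : 'M[R]_m) (B : 'M[R]_(n, m)).
Hypotheses (G_sym : G^T = G) (G_pos : forall v, v != 0 -> 0 < pairing G v v).
Hypothesis B_inj : forall u : 'rV[R]_n, u *m B = 0 -> u = 0.

Lemma pairing_induced u v :
  pairing (B *m G *m B^T) u v = pairing G (u *m B) (v *m B).
Proof. by rewrite /pairing trmx_mul !mulmxA. Qed.

Lemma push_pairing_gt0 u : u != 0 -> 0 < pairing G (u *m B) (u *m B).
Proof. by move=> u0; apply: G_pos; apply: contra_neq u0; exact: B_inj. Qed.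

Lemma induced_unitmx : B *m G *m B^T \in unitmx.
Proof.
by apply: posdef_unitmx => v v0; rewrite pairing_induced push_pairing_gt0.
Qed.

(** Orthogonal projection of w onto the row space of B, in coordinates with
respect to the rows of B: the solution a of the normal equations
a *m (B *m G *m B^T) = w *m G *m B^T. *)
Definition tangential (w : 'rV[R]_m) : 'rV[R]_n :=
  w *m G *m B^T *m invmx (B *m G *m B^T).

Lemma tangentialP w v :
  pairing G (tangential w *m B) (v *m B) = pairing G w (v *m B).
Proof.
rewrite -pairing_induced {1}/pairing mulmxKV ?induced_unitmx //.
by rewrite /pairing trmx_mul !mulmxA.
Qed.

Lemma tangentialD w w' : tangential (w + w') = tangential w + tangential w'.
Proof. by rewrite /tangential !mulmxDl. Qed.

Lemma orthogonal_pushP (w : 'rV[R]_m) :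
  reflect (forall v, pairing G w (v *m B) = 0) (w <= kermx (G *m B^T))%MS.
Proof.
apply: (iffP sub_kermxP) => [wB v|wB].
  by rewrite /pairing trmx_mul !mulmxA -(mulmxA w) wB mul0mx mxE.
apply/rowP => j; have := wB (delta_mx 0 j).
rewrite /pairing trmx_mul mulmxA trmx_delta -colE.
by rewrite mxE -mulmxA => ->; rewrite mxE.
Qed.

Lemma normal_cap_tangent : (kermx (G *m B^T) :&: <<B>>)%MS = 0.
Proof.
apply/eqP/rowV0P => w; rewrite sub_capmx genmxE => /andP[/orthogonal_pushP wN].
move=> /submxP[v wE]; apply/eqP.
by rewrite -(pairing_eq0 G_pos) {2}wE wN.
Qed.

(** The normal space and the tangent space are complementary: any w is the sum of
[tangential w *m B] and of a vector orthogonal to the rows of B. *)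
Lemma normal_tangent_decomp (w : 'rV[R]_m) :
  let nw := w *m proj_mx (kermx (G *m B^T)) <<B>>%MS in
  (forall v, pairing G nw (v *m B) = 0) /\ exists a, w = nw + a *m B.
Proof.
split; first by apply/orthogonal_pushP; exact: proj_mx_sub.
have wNT : (w <= kermx (G *m B^T) + <<B>>)%MS.
  rewrite -[w](subrK (tangential w *m B)); apply: addmx_sub_adds.
    by apply/orthogonal_pushP => v; rewrite pairingDl pairingNl tangentialP subrr.
  by rewrite genmxE submxMl.
have /submxP[a aE] : (w *m proj_mx <<B>>%MS (kermx (G *m B^T)) <= B)%MS.
  by rewrite -(genmxE B) proj_mx_sub.
exists a; rewrite -aE; apply/esym; apply: add_proj_mx wNT.
exact: normal_cap_tangent.
Qed.

End TangentNormal.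

(** * Slant subspaces of a Hermitian vector space *)

Section SlantPoint.
Context {R : realType} {n m : nat} (G J : 'M[R]_m) (B : 'M[R]_(n, m)) (c : R).
Hypotheses (G_sym : G^T = G) (G_pos : forall v, v != 0 -> 0 < pairing G v v).
Hypothesis B_inj : forall u : 'rV[R]_n, u *m B = 0 -> u = 0.
Hypotheses (J_sqr : J *m J = - 1%:M)
  (J_isom : forall u v, pairing G (u *m J) (v *m J) = pairing G u v).

Let P u := tangential G B (u *m B *m J).

Hypothesis P_slant : forall u,
  pairing G (P u *m B) (P u *m B) = c * pairing G (u *m B) (u *m B).

(** From J^2 = - 1: g(J u, v) = g(J J u, J v) = - g(u, J v). *)
Lemma acs_skew u v : pairing G (u *m J) v = - pairing G u (v *m J).
Proof.
by rewrite -[LHS]J_isom -[u *m J *m J]mulmxA J_sqr mulmxN mulmx1 pairingNl.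
Qed.

Lemma acs_orth u : pairing G (u *m J) u = 0.
Proof. by have := acs_skew u u; rewrite [in RHS]pairingC // => h; lra. Qed.

Lemma slant_tangentialP u v :
  pairing G (P u *m B) (v *m B) = pairing G (u *m B *m J) (v *m B).
Proof. exact: tangentialP. Qed.

(** Polarization of |P u|^2 = c |u|^2, using g(J u, P v) = g(P u, P v). *)
Lemma slant_polar u v :
  pairing G (u *m B *m J) (P v *m B) = c * pairing G (u *m B) (v *m B).
Proof.
have PD : P (u + v) = P u + P v by rewrite /P !mulmxDl tangentialD.
have := P_slant (u + v); rewrite PD !mulmxDl !(pairingDl, pairingDr) !P_slant.
rewrite (pairingC (P v *m B) (P u *m B)) // (pairingC (v *m B) (u *m B)) //.
rewrite (slant_tangentialP u (P v)) => h; lra.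
Qed.

(** The tangent space T and J T are complementary.  If x + J y = 0 with x and y
tangent, then J y is tangent, so P y = J y has the length of y; this contradicts
|P y|^2 = c |y|^2 unless y = 0.  Both spaces have dimension n, and m = 2n. *)
Lemma slant_normal_trivial (H : 'rV[R]_m) : m = (2 * n)%N -> c != 1 ->
  (forall v, pairing G H (v *m B) = 0) ->
  (forall v, pairing G H (v *m B *m J) = 0) -> H = 0.
Proof.
move=> mE c1 HB HBJ.
have full : row_full (col_mx B (B *m J)).
  suff : row_free (col_mx B (B *m J)).
    by rewrite /row_free /row_full => /eqP ->; rewrite mE mul2n addnn.
  rewrite -kermx_eq0; apply/rowV0P => w /sub_kermxP.
  rewrite -[w]hsubmxK mul_row_col; set x := lsubmx w; set y := rsubmx w.
  rewrite mulmxA => /eqP; rewrite addr_eq0 => /eqP xE.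
  have PyE : P y = - x.
    apply/eqP; rewrite -subr_eq0 opprK; apply/eqP; apply: B_inj; apply/eqP.
    rewrite -(pairing_eq0 G_pos) {1}mulmxDl pairingDl slant_tangentialP.
    by rewrite xE pairingNl addrN.
  have y0 : y = 0.
    apply: B_inj; apply/eqP; rewrite -(pairing_eq0 G_pos).
    have := P_slant y; rewrite PyE mulNmx xE opprK J_isom => /eqP.
    by rewrite -subr_eq0 -{1}[pairing _ _ _]mul1r -mulrBl mulf_eq0 subr_eq0
      eq_sym (negbTE c1).
  have -> : x = 0 by apply: B_inj; rewrite xE y0 !mul0mx oppr0.
  by rewrite y0 row_mx0.
have /submxP[D HE] := submx_full H full.
apply/eqP; rewrite -(pairing_eq0 G_pos) {2}HE -[D]hsubmxK mul_row_col.
by rewrite pairingDr HB mulmxA HBJ addr0.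
Qed.

(* N k u stands for the ambient covariant derivative along k of the pushed
   forward field u, and H for the mean curvature vector. *)
Variables (N : 'rV[R]_n -> 'rV[R]_n -> 'rV[R]_m) (H : 'rV[R]_m).
Hypothesis H_normal : forall v, pairing G H (v *m B) = 0.
Hypothesis N_umbilical : forall k u,
  exists a, N k u = pairing G (k *m B) (u *m B) *: H + a *m B.

(** The hypothesis is the vanishing of the derivative along k of
c |u|^2 |y|^2 - g(J u, y)^2 at the critical pair (u, P u).  By [slant_polar] the
tangential parts of N k u and N k y contribute nothing: they are derivatives of
the same function in the variables u and y, where it is also minimal.  The
component along H contributes 2 c |u|^4 g(H, J (P u)) when k = u. *)
Lemma slant_proper_orth : c != 0 ->
  (forall k u y, y = P u ->
    c * ((pairing G (N k u) (u *m B) + pairing G (u *m B) (N k u))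
           * pairing G (y *m B) (y *m B)
         + pairing G (u *m B) (u *m B)
           * (pairing G (N k y) (y *m B) + pairing G (y *m B) (N k y)))
    = 2 * pairing G (u *m B *m J) (y *m B)
      * (pairing G (N k u *m J) (y *m B) + pairing G (u *m B *m J) (N k y))) ->
  forall v, pairing G H (v *m B *m J) = 0.
Proof.
move=> c0 crit.
have HP u : pairing G H (P u *m B *m J) = 0.
  have [->|u0] := eqVneq u 0.
    by rewrite /P /tangential !mul0mx pairing0r.
  have := crit u u (P u) erefl; set y := P u.
  have [a ->] := N_umbilical u u; have [b ->] := N_umbilical u y.
  have -> : pairing G (u *m B) (y *m B) = 0.
    by rewrite pairingC // slant_tangentialP acs_orth.
  rewrite scale0r add0r !mulmxDl -!scalemxAl !(pairingDl, pairingDr).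
  rewrite !(pairingZl, pairingZr).
  rewrite (pairingC (u *m B) H) // !H_normal.
  rewrite (acs_skew H) (slant_polar u u) (slant_polar a u).
  rewrite -(slant_tangentialP u b) -/y {3}/y P_slant.
  rewrite (pairingC (u *m B) (a *m B)) // (pairingC (b *m B) (y *m B)) //.
  have := push_pairing_gt0 G_pos B_inj u0.
  set q := pairing G (u *m B) (u *m B); set al := pairing G H _.
  move=> q0 /eqP; rewrite -subr_eq0 => /eqP E.
  have : 2 * c * (q * q) * al = 0 by rewrite -E; ring.
  by move/eqP; rewrite !mulf_eq0 (negbTE c0) (gt_eqF q0) pnatr_eq0
    /= => /eqP.
(* P is onto: its matrix PM is injective because |P u|^2 = c |u|^2. *)
pose PM := B *m J *m G *m B^T *m invmx (B *m G *m B^T).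
have PE u : P u = u *m PM by rewrite /P /tangential /PM !mulmxA.
have PM_unit : PM \in unitmx.
  rewrite -row_free_unit -kermx_eq0; apply/rowV0P => u /sub_kermxP.
  rewrite -PE => Pu0; apply: B_inj; apply/eqP; rewrite -(pairing_eq0 G_pos).
  have /esym/eqP := P_slant u; rewrite Pu0 mul0mx pairing0l.
  by rewrite mulf_eq0 (negbTE c0).
by move=> v; rewrite -[v](mulmxKV PM_unit) -PE HP.
Qed.

(** In the Lagrangian case omega(u, v) = g(J u, v) vanishes identically on M, and
with it its derivative.  The tangential parts of N k u and N k v only enter that
derivative through omega, so they drop out.  For u = k orthogonal to v, what
remains is - |k|^2 g(H, J v); such a k != 0 exists because n >= 2. *)
Lemma slant_lagrangian_orth : (2 <= n)%N ->
  (forall u v, pairing G (u *m B *m J) (v *m B) = 0) ->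
  (forall k u v,
    pairing G (N k u *m J) (v *m B) + pairing G (u *m B *m J) (N k v) = 0) ->
  forall v, pairing G H (v *m B *m J) = 0.
Proof.
move=> n2 w0 dw0 v; have [->|v0] := eqVneq v 0.
  by rewrite !mul0mx pairing0r.
have [k k0 kv] : exists2 k, k != 0 & pairing G (k *m B) (v *m B) = 0.
  pose A : 'M[R]_(n, 1) := B *m G *m (v *m B)^T.
  have : kermx A != 0.
    rewrite kermx_eq0 /row_free neq_ltn; apply/orP; left.
    exact: leq_ltn_trans (rank_leq_col A) n2.
  case/rowV0Pn => k /sub_kermxP kA k0; exists k => //.
  by rewrite /pairing -!mulmxA [_ *m (_ *m _^T)]mulmxA kA mxE.
have := dw0 k k v.
have [a ->] := N_umbilical k k; have [b ->] := N_umbilical k v.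
rewrite kv scale0r add0r !mulmxDl -!scalemxAl !(pairingDl, pairingDr).
rewrite !pairingZl !w0 !addr0 acs_skew => /eqP.
by rewrite mulf_eq0 (gt_eqF (push_pairing_gt0 G_pos B_inj k0)) oppr_eq0
  => /eqP.
Qed.

End SlantPoint.

(** * The Levi-Civita connection and fields along a map *)

Section LeviCivita.
Context {R : realType} {m : nat} (g : 'rV[R]_m -> 'M[R]_m) (y : 'rV[R]_m).
Hypotheses (g_diff : differentiable g y) (g_unit : g y \in unitmx).
Hypothesis g_sym : \forall z \near y, (g z)^T = g z.

Let d i j l := partial i (fun z => g z j l) y.

Lemma metric_partial_sym i j l : d i j l = d i l j.
Proof.
apply: near_eq_derive; apply: filterS g_sym => z gz.
by rewrite -[in LHS]gz mxE.
Qed.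

(** Lowering the upper index of the Christoffel symbols cancels the inverse
metric in their definition. *)
Lemma christoffel_lowered w a b :
  pairing (g y) (christoffel_form g y w a) b =
  2^-1 * \sum_i \sum_j \sum_l
    w 0 i * a 0 j * b 0 l * (d i j l + d j i l - d l i j).
Proof.
pose r : 'rV[R]_m :=
  \row_l \sum_i \sum_j w 0 i * a 0 j * (d i j l + d j i l - d l i j).
have gT := nbhs_singleton g_sym.
have -> : christoffel_form g y w a = 2^-1 *: (r *m invmx (g y)).
  apply/rowP => k; rewrite !mxE mulr_sumr.
  under eq_bigr => i _ do under eq_bigr => j _ do
    rewrite /christoffel mulrA mulr_sumr.
  under eq_bigr => i _ do rewrite exchange_big /=.
  rewrite exchange_big /=; apply: eq_bigr => l _.
  rewrite mxE mulrA mulr_sumr mulr_suml; apply: eq_bigr => i _.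
  rewrite mulr_sumr mulr_suml; apply: eq_bigr => j _.
  have -> : invmx (g y) k l = invmx (g y) l k.
    by rewrite -[in LHS]gT -trmx_inv mxE.
  rewrite /d; ring.
rewrite pairingZl /pairing mulmxKV // mxE; congr (_ * _).
under eq_bigr => l _ do rewrite !mxE mulr_suml.
rewrite exchange_big; apply: eq_bigr => i _ /=.
under eq_bigr => l _ do rewrite mulr_suml.
rewrite exchange_big; apply: eq_bigr => j _ /=.
apply: eq_bigr => l _; ring.
Qed.

(** The Levi-Civita connection preserves the metric: in the sum of the two
lowered symbols, all partial derivatives cancel but the one along w. *)
Lemma christoffel_metric w a b :
  pairing ('D_w g y) a b =
  pairing (g y) (christoffel_form g y w a) b
  + pairing (g y) a (christoffel_form g y w b).
Proof.
have gT := nbhs_singleton g_sym.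
rewrite (pairingC a _ gT) !christoffel_lowered -mulrDr -big_split /=.
rewrite pairingE.
have -> : \sum_i \sum_j a 0 i * b 0 j * ('D_w g y) i j =
    \sum_i \sum_j \sum_l w 0 i * a 0 j * b 0 l * d i j l.
  rewrite [RHS]exchange_big; apply: eq_bigr => j _ /=.
  rewrite [RHS]exchange_big; apply: eq_bigr => l _ /=.
  rewrite derive_partial // summxE mulr_sumr; apply: eq_bigr => i _.
  rewrite mxE /partial derive_mx; last exact: diff_derivable.
  rewrite mxE /d /partial; ring.
rewrite mulr_sumr; apply: eq_bigr => i _.
rewrite [X in _ + X]exchange_big -big_split mulr_sumr; apply: eq_bigr => j _.
rewrite -big_split mulr_sumr; apply: eq_bigr => l _ /=.
rewrite (metric_partial_sym i l j); by field.
Qed.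

End LeviCivita.

Section FieldsAlongMap.
Context {R : realType} {n m : nat}.
Variables (g : 'rV[R]_m -> 'M[R]_m) (F : 'rV[R]_n -> 'rV[R]_m) (x k : 'rV[R]_n).
Hypotheses (F_diff : differentiable F x) (g_diff : differentiable g (F x)).
Hypotheses (g_unit : g (F x) \in unitmx)
  (g_sym : \forall z \near F x, (g z)^T = g z).

(* Covariant derivative along k of a field a along F with derivative da. *)
Let nabla (a : 'rV[R]_n -> 'rV[R]_m) da :=
  da + christoffel_form g (F x) ('d F x k) (a x).

Lemma is_derive_pairing_along a b da db :
  is_derive x k a da -> is_derive x k b db ->
  is_derive x k (fun z => pairing (g (F z)) (a z) (b z))
    (pairing (g (F x)) (nabla a da) (b x)
     + pairing (g (F x)) (a x) (nabla b db)).
Proof.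
move=> ax bx.
apply: (is_derive_eq
  (is_derive_pairing (is_derive_comp_diff k F_diff g_diff) ax bx)).
rewrite christoffel_metric // /nabla !(pairingDl, pairingDr); ring.
Qed.

(** As J is parallel, it commutes with the covariant derivative of fields along
F. *)
Lemma is_derive_acs_along (J : 'rV[R]_m -> 'M[R]_m) a da :
  differentiable J (F x) -> is_derive x k a da ->
  (forall u v, cov_deriv_endo g J (F x) u v = 0) ->
  exists2 da', is_derive x k (fun z => a z *m J (F z)) da' &
    nabla (fun z => a z *m J (F z)) da' = nabla a da *m J (F x).
Proof.
move=> J_diff ax J_par.
exists (da *m J (F x) + a x *m 'D_('d F x k) J (F x)).
  exact: is_derive_mulmx ax (is_derive_comp_diff k F_diff J_diff).
have /eqP := J_par ('d F x k) (a x); rewrite subr_eq0 => /eqP E.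
by rewrite /nabla mulmxDl -addrA E.
Qed.

End FieldsAlongMap.

(** * Immersions in local coordinates *)

Section LocalCoordinates.
Context {R : realType} {n m : nat} (M : smoothManifold R n)
  (N : smoothManifold R m) (f : M -> N).

(** This turns the conditions imposed at the points of M into properties valid
near a point of the coordinate space, where minimality can be expressed. *)
Lemma near_chart p (c : chart M) (d : chart N) : continuous f ->
  charts_at f p c d ->
  \forall z \near ccoord c p, exists2 q, charts_at f q c d & ccoord c q = z.
Proof.
move=> cf [pc fpd].
have O_nbhs : nbhs p (cdom c `&` f @^-1` cdom d).
  apply: filterI; first exact: open_nbhs_nbhs (conj (cdom_open c) pc).
  exact: cf (open_nbhs_nbhs (conj (cdom_open d) fpd)).
have cpar : \forall z \near ccoord c p, (cdom c `&` f @^-1` cdom d) (cparam c z).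
  apply: (cparam_continuous pc); by rewrite ccoordK.
have img : nbhs (ccoord c p) (ccoord c @` cdom c).
  by apply: open_nbhs_nbhs; split; [exact: ccoord_open|exists p].
apply: filterS2 cpar img => z Oz [q qc qz].
by exists q => //; move: Oz; rewrite -qz ccoordK.
Qed.

Lemma local_repE p (c : chart M) (d : chart N) : cdom c p ->
  local_rep f c d (ccoord c p) = ccoord d (f p).
Proof. by move=> pc; rewrite /local_rep /= ccoordK. Qed.

Lemma local_rep_smooth p (c : chart M) (d : chart N) : smooth_map f ->
  charts_at f p c d ->
  (\forall z \near ccoord c p, differentiable (local_rep f c d) z) /\
  forall i, differentiable (partial i (local_rep f c d)) (ccoord c p).
Proof.
move=> [cf /(_ c d) sf] pcd; split.
  apply: filterS (near_chart cf pcd) => z [q [qc fqd] qz].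
  by apply: (sf 1%N).1; exists q.
move=> i; have [_ /(_ i) /= [+ _]] := sf 2; apply; exists p => //.
Qed.

Lemma push_diff p (c : chart M) (d : chart N) u :
  'd (local_rep f c d) (ccoord c p) u = u *m push f p c d.
Proof. by rewrite /push /jacobian mul_rV_lin1. Qed.

Lemma push_inj p (c : chart M) (d : chart N) (u : 'rV[R]_n) : immersion f ->
  charts_at f p c d -> u *m push f p c d = 0 -> u = 0.
Proof.
move=> [_ fi] pcd; rewrite -push_diff => u0.
by apply: (fi p c d pcd); rewrite u0 linear0.
Qed.

End LocalCoordinates.

(** * Submanifolds of Kaehler manifolds *)

Section Submanifold.
Context {R : realType} {n m : nat} (M : smoothManifold R n)
  (N : kaehlerManifold R m) (f : M -> N) (p : M) (c : chart M) (d : chart N).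
Hypotheses (f_imm : immersion f) (pcd : charts_at f p c d).

Let F := local_rep f c d.
Let x := ccoord c p.
Let B := push f p c d.
Let G := metric d (ccoord d (f p)).
Let J := acs d (ccoord d (f p)).

Let G_sym : G^T = G.
Proof. exact: Defs.metric_sym pcd.2. Qed.

Let G_pos v : v != 0 -> 0 < pairing G v v.
Proof. exact: metric_pos pcd.2 v. Qed.

Let B_inj (u : 'rV[R]_n) : u *m B = 0 -> u = 0.
Proof. exact: push_inj. Qed.

(** Ambient covariant derivative along k of the pushed forward field f_* u, for u
constant in the chart; its normal part is the second fundamental form. *)
Definition ambient_cov (k u : 'rV[R]_n) : 'rV[R]_m :=
  'D_k (fun z => 'd F z u) x
  + christoffel_form (metric d) (ccoord d (f p)) ('d F x k) ('d F x u).

(** This and [fundamental_form] are the induced metric and the restriction of the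
Kaehler form g(J -, -), evaluated on the constant fields u and v of the chart. *)
Definition induced_pairing (u v z : 'rV[R]_n) : R :=
  pairing (metric d (F z)) ('d F z u) ('d F z v).

Definition fundamental_form (u v z : 'rV[R]_n) : R :=
  pairing (metric d (F z)) ('d F z u *m acs d (F z)) ('d F z v).

Let Fx : F x = ccoord d (f p).
Proof. exact: local_repE pcd.1. Qed.

Lemma induced_pairingE u v :
  induced_pairing u v x = pairing G (u *m B) (v *m B).
Proof. by rewrite /induced_pairing Fx !(push_diff f p c d). Qed.

Lemma fundamental_formE u v :
  fundamental_form u v x = pairing G (u *m B *m J) (v *m B).
Proof. by rewrite /fundamental_form Fx !(push_diff f p c d). Qed.

Let coord_img : (ccoord d @` cdom d) (ccoord d (f p)).
Proof. by exists (f p) => //; exact: pcd.2. Qed.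

Let F_diff : differentiable F x.
Proof. exact: nbhs_singleton (local_rep_smooth f_imm.1 pcd).1. Qed.

Let dF_derive k u :
  is_derive x k (fun z => 'd F z u) ('D_k (fun z => 'd F z u) x).
Proof.
have [Fd dFd] := local_rep_smooth f_imm.1 pcd.
by apply: derivableP; exact: derivable_diff_const.
Qed.

Let g_diff : differentiable (metric d) (F x).
Proof. by rewrite Fx; exact: (metric_smooth d 1%N).1. Qed.

Let J_diff : differentiable (acs d) (F x).
Proof. by rewrite Fx; exact: (acs_smooth d 1%N).1. Qed.

Let g_unit : metric d (F x) \in unitmx.
Proof. by rewrite Fx; apply: posdef_unitmx; exact: G_pos. Qed.

Let g_sym : \forall z \near F x, (metric d z)^T = metric d z.
Proof.
have : nbhs (F x) (ccoord d @` cdom d).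
  by rewrite Fx; apply: open_nbhs_nbhs; split; first exact: ccoord_open.
by apply: filterS => z [q qd <-]; exact: Defs.metric_sym.
Qed.

Lemma is_derive_induced_pairing k u v :
  is_derive x k (induced_pairing u v)
    (pairing G (ambient_cov k u) (v *m B)
     + pairing G (u *m B) (ambient_cov k v)).
Proof.
have := is_derive_pairing_along F_diff g_diff g_unit g_sym
  (dF_derive k u) (dF_derive k v).
by rewrite Fx -(push_diff f p c d u) -(push_diff f p c d v).
Qed.

Lemma is_derive_fundamental_form k u v :
  is_derive x k (fundamental_form u v)
    (pairing G (ambient_cov k u *m J) (v *m B)
     + pairing G (u *m B *m J) (ambient_cov k v)).
Proof.
have J_par w w' : cov_deriv_endo (metric d) (acs d) (F x) w w' = 0.
  by rewrite Fx; exact: acs_parallel pcd.2 w w'.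
have [da' dJ E] := is_derive_acs_along F_diff J_diff (dF_derive k u) J_par.
have := is_derive_pairing_along F_diff g_diff g_unit g_sym dJ (dF_derive k v).
by rewrite E Fx -(push_diff f p c d u) -(push_diff f p c d v).
Qed.

Lemma mean_curvature_normal (v : 'rV[R]_n) :
  pairing G (mean_curvature f p c d) (v *m B) = 0.
Proof.
apply: (elimT (orthogonal_pushP G B _)) v; apply: scalemx_sub.
apply: summx_sub => a _; apply: summx_sub => b _; apply: scalemx_sub; exact: proj_mx_sub.
Qed.

(** The vector a is the tangential part, that is, the covariant derivative of u
along k for the induced connection. *)
Lemma umbilical_ambient_cov : totally_umbilical f -> forall k u,
  exists a, ambient_cov k u
    = pairing G (k *m B) (u *m B) *: mean_curvature f p c d + a *m B.
Proof.
move=> f_umb k u.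
have [_ [a E]] := normal_tangent_decomp G_pos B_inj (ambient_cov k u).
exists a; rewrite {1}E; congr (_ + _).
by have := f_umb p c d pcd k u; rewrite pairing_induced.
Qed.

(** The vector t is P u, and J u has the length of u.  The ratio of lengths lies
in [0, 1], so its arc cosine determines it. *)
Lemma wirtinger_angle_cos (theta : R) : slant_with_angle f theta ->
  forall u, u != 0 ->
  let t := tangential G B (u *m B *m J) *m B in
  let r := Num.sqrt (pairing G t t) / Num.sqrt (pairing G (u *m B) (u *m B)) in
  theta = acos r /\ r = cos theta.
Proof.
move=> f_slant u u0 t r; rewrite /r.
have uB0 : u *m B != 0 by apply: contra_neq u0; exact: B_inj.
have J_isom v w : pairing G (v *m J) (w *m J) = pairing G v w.
  exact: acs_isometry pcd.2 v w.
have uBJ0 : u *m B *m J != 0.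
  by rewrite -(pairing_eq0 G_pos) J_isom pairing_eq0 //; exact: G_pos.
have tP w : (w <= <<B>>)%MS -> pairing G (u *m B *m J) w = pairing G t w.
  rewrite genmxE => /submxP[D ->].
  by rewrite (tangentialP G_pos B_inj).
have tW : (t <= <<B>>)%MS by rewrite genmxE submxMl.
have thetaE : theta = acos (Num.sqrt (pairing G t t)
    / Num.sqrt (pairing G (u *m B) (u *m B))).
  rewrite -(f_slant p c d pcd u u0) /wirtinger_angle push_diff.
  rewrite (subspace_angleE G_sym G_pos uBJ0 _ tW tP) ?J_isom //.
  apply: contra_neq uB0 => B0; apply/eqP.
  by rewrite -submx0 -B0 genmxE submxMl.
split=> //; rewrite thetaE acosK // in_itv /=; apply/andP; split.
  by rewrite (@le_trans _ _ 0) ?lerN10 // divr_ge0 // sqrtr_ge0.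
have q0 : 0 < pairing G (u *m B) (u *m B) by exact: G_pos.
rewrite ler_pdivrMr ?sqrtr_gt0 // mul1r ler_wsqrtr //.
have [->|t0] := eqVneq t 0; first by rewrite pairing0l ltW.
have := cauchy_schwarz G_sym G_pos (u *m B *m J) t.
by rewrite tP // J_isom expr2 ler_pM2r // G_pos.
Qed.

Lemma slant_tangential_norm (theta : R) : slant_with_angle f theta -> forall u,
  let t := tangential G B (u *m B *m J) *m B in
  pairing G t t = cos theta ^+ 2 * pairing G (u *m B) (u *m B).
Proof.
move=> f_slant u t; have [u0|u0] := eqVneq u 0.
  by rewrite /t u0 /tangential !mul0mx !pairing0l mulr0.
have [_ <-] := wirtinger_angle_cos f_slant u0.
rewrite expr_div_n !sqr_sqrtr ?pairing_ge0 //; try exact: G_pos.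
by rewrite divfK // gt_eqF // (push_pairing_gt0 G_pos B_inj).
Qed.

(** As cos theta is a ratio of lengths, it is nonnegative, so cos^2 theta = 1
would give cos theta = 1 and theta = acos 1 = 0. *)
Lemma slant_cos_neq1 (theta : R) : (0 < n)%N -> slant_with_angle f theta ->
  theta != 0 -> cos theta ^+ 2 != 1.
Proof.
move=> n0 f_slant; apply: contra_neq => cos1.
have u0 : const_mx 1 != 0 :> 'rV[R]_n.
  by apply/eqP => /rowP/(_ (Ordinal n0)); rewrite !mxE => /eqP; rewrite oner_eq0.
have [thetaE cosE] := wirtinger_angle_cos f_slant u0.
rewrite thetaE cosE; have cos_ge0 : 0 <= cos theta.
  by rewrite -cosE divr_ge0 // sqrtr_ge0.
have -> : cos theta = 1.
  by apply/eqP; rewrite -(@eqrXn2 _ 2) // cos1 expr1n.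
exact: acos1.
Qed.

End Submanifold.

(** * Umbilical slant submanifolds *)

Theorem theorem5p4 (R : realType) (n : nat) (hn : (2 <= n)%N)
  (N : kaehlerManifold R (2 * n)) (M : smoothManifold R n) (f : M -> N)
  (hf : immersion f) (hslant : non_invariant_slant f)
  (humb : totally_umbilical f) : totally_geodesic f.
Proof.
move=> p c d pcd u v; rewrite humb //.
suff -> : mean_curvature f p c d = 0 by rewrite scaler0.
have [theta f_slant theta0] := hslant.
have G_sym q (qcd : charts_at f q c d) := Defs.metric_sym qcd.2.
have G_pos q (qcd : charts_at f q c d) v := @metric_pos _ _ _ _ _ qcd.2 v.
have B_inj q (qcd : charts_at f q c d) (w : 'rV[R]_n) :
  w *m push f q c d = 0 -> w = 0 by exact: push_inj.
have J_sqr := acs_sqr pcd.2.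
have J_isom := acs_isometry pcd.2.
have norm q qcd := @slant_tangential_norm _ _ _ _ _ f q c d hf qcd _ f_slant.
have c1 : cos theta ^+ 2 != 1.
  exact (slant_cos_neq1 hf pcd (ltnW hn) f_slant theta0).
apply: (slant_normal_trivial (G_pos p pcd) (B_inj p pcd) J_isom (norm p pcd)
  erefl c1).
  by move=> w; exact: mean_curvature_normal.
have near_p := near_chart hf.1.1 pcd.
have hE q (qcd : charts_at f q c d) := induced_pairingE qcd.
have wE q (qcd : charts_at f q c d) := fundamental_formE qcd.
have umb := umbilical_ambient_cov hf pcd humb.
have Dh := is_derive_induced_pairing hf pcd.
have Dw := is_derive_fundamental_form hf pcd.
have [cos0|cos0] := eqVneq (cos theta ^+ 2) 0.
  have w0 q : charts_at f q c d -> forall a b, pairing (metric d (ccoord d (f q)))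
      (a *m push f q c d *m acs d (ccoord d (f q))) (b *m push f q c d) = 0.
    move=> qcd a b; rewrite -(tangentialP (G_pos q qcd) (B_inj q qcd)).
    have /eqP := norm q qcd a; rewrite cos0 mul0r (pairing_eq0 (G_pos q qcd)).
    by move=> /eqP ->; rewrite pairing0l.
  apply: (slant_lagrangian_orth (G_pos p pcd) (B_inj p pcd) J_sqr J_isom
    umb hn (w0 p pcd)) => k a b.
  (* The fundamental form vanishes near p, so its value at p is a minimum. *)
  apply: (is_derive_local_min (Dw k a b)).
  apply: filterS near_p => z [q qcd <-].
  by rewrite [leLHS](wE p pcd) [leRHS](wE q qcd) !w0.
apply: (slant_proper_orth (G_sym p pcd) (G_pos p pcd) (B_inj p pcd) J_sqr J_isom
  (norm p pcd) (mean_curvature_normal f p c d) umb cos0) => k a b bE.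
(* The minimum is reached at p, since there b = P a. *)
have := is_derive_slant_defect (cos theta ^+ 2) (Dh k a a) (Dh k b b) (Dw k a b).
set defect := fun z => _ => D_defect.
have defect_ge0 q : charts_at f q c d -> 0 <= defect (ccoord c q).
  move=> qcd; rewrite /defect !(hE q qcd) (wE q qcd) subr_ge0.
  rewrite -(tangentialP (G_pos q qcd) (B_inj q qcd)).
  apply: le_trans (cauchy_schwarz (G_sym q qcd) (G_pos q qcd) _ _) _.
  by rewrite (norm q qcd) mulrA.
have wab : pairing (metric d (ccoord d (f p)))
    (a *m push f p c d *m acs d (ccoord d (f p))) (b *m push f p c d)
    = cos theta ^+ 2 * pairing (metric d (ccoord d (f p)))
        (a *m push f p c d) (a *m push f p c d).
  by rewrite bE (slant_polar (G_sym p pcd) (G_pos p pcd) (B_inj p pcd)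
    (norm p pcd)).
have defect0 : defect (ccoord c p) = 0.
  rewrite /defect !(hE p pcd) (wE p pcd) wab bE (norm p pcd); ring.
have defect_min : \forall z \near ccoord c p, defect (ccoord c p) <= defect z.
  apply: filterS near_p => z [q qcd <-]; rewrite [leLHS]defect0.
  exact: defect_ge0.
move: (is_derive_local_min D_defect defect_min).
by rewrite !(hE p pcd) (wE p pcd) => /eqP; rewrite subr_eq0 => /eqP.
Qed.
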